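(* Let $a>0$, $n\ge1$, and let $y:[-a,a]\to\mathbb{C}$ be continuous. Let $P_1,\dots,P_n$ be the polynomials (defined in the context) forming the quadratic spline $S$ that interpolates $y$ at the $n+1$ equidistant nodes $x_k=-a+kh$, $h=\frac{2a}{n}$, $k=0,\dots,n$. 1) If $y$ is even, then $P_k(x)=P_{n-k+1}(-x)$ for $k=1,2,\dots,n$ (as polynomials in $x$). 2) If $y$ is odd, then $P_k(x)=-P_{n-k+1}(-x)$ for $k=1,2,\dots,n$ (as polynomials in $x$).
   Context: Definition of the spline $S$ and its polynomials: with $y_k=y(x_k)$ and $\Delta_j=\frac{y_{j-1}-2y_j+y_{j+1}}{h^2}$ for $1\le j\le n-1$, $S$ is the function equal on $[x_{k-1},x_k]$ ($k=1,\dots,n$) to $$P_k(x)=\frac{x-x_{k-1}}{h}y_k-\frac{x-x_k}{h}y_{k-1}+a_k(x-x_{k-1})(x-x_k),$$ where $$a_1=-\frac1n\sum_{j=1}^{n-1}(n-j)(-1)^j\Delta_j,\qquad a_k=(-1)^{k+1}\Big(a_1+\sum_{j=1}^{k-1}(-1)^j\Delta_j\Big)\quad(2\le k\le n),$$ and empty sums are $0$. (The symbol $a$ without index is the half-length of the interval; $a_k$ with index are the spline coefficients.) *)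

(* Defs.v *)
From HB Require Import structures.
From mathcomp Require Import all_boot all_order all_algebra.
From mathcomp Require Import complex.
From mathcomp Require Import all_classical all_reals all_analysis.

Set Implicit Arguments.
Unset Strict Implicit.
Unset Printing Implicit Defensive.

Import Order.TTheory GRing.Theory Num.Theory.
Import numFieldNormedType.Exports.

Local Open Scope classical_set_scope.
Local Open Scope complex_scope.
Local Open Scope ring_scope.

(* A function y on [-a, a] is represented by a total function on R. The spline
   only involves the values of y at the nodes, all of which lie in [-a, a]. *)

Definition even_on {R : realType} (a : R) (y : R -> R[i]) : Prop :=
  forall x : R, x \in `[- a, a] -> y (- x) = y x.

Definition odd_on {R : realType} (a : R) (y : R -> R[i]) : Prop :=
  forall x : R, x \in `[- a, a] -> y (- x) = - y x.

Section QuadraticSpline.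

Variables (R : realType) (a : R) (n : nat) (y : R -> R[i]).

Definition step : R := 2 * a / n%:R.

Definition node (k : nat) : R := - a + k%:R * step.

(* Central second difference quotient; meaningful for 1 <= j <= n - 1. *)
Definition second_diff (j : nat) : R[i] :=
  (y (node j.-1) - 2 * y (node j) + y (node j.+1)) / (step ^+ 2)%:C.

Definition spline_coef1 : R[i] :=
  - (n%:R)^-1 * \sum_(1 <= j < n) (n - j)%:R * (-1) ^+ j * second_diff j.

(* For k = 1 the inner sum is empty and the value is spline_coef1. *)
Definition spline_coef (k : nat) : R[i] :=
  (-1) ^+ k.+1 *
    (spline_coef1 + \sum_(1 <= j < k) (-1) ^+ j * second_diff j).

(* The piece on [node k.-1, node k], for 1 <= k <= n. *)
Definition spline_poly (k : nat) : {poly R[i]} :=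
  let l : {poly R[i]} := 'X - (node k.-1)%:C%:P in
  let r : {poly R[i]} := 'X - (node k)%:C%:P in
  (y (node k) / step%:C) *: l - (y (node k.-1) / step%:C) *: r
    + spline_coef k *: (l * r).

End QuadraticSpline.

(* Main.v *)
Require Import Defs.
From HB Require Import structures.
From mathcomp Require Import all_boot all_order all_algebra.
From mathcomp Require Import complex.
From mathcomp Require Import all_classical all_reals all_analysis.
From mathcomp Require Import ring zify.

Set Implicit Arguments.
Unset Strict Implicit.
Unset Printing Implicit Defensive.

Import Order.TTheory GRing.Theory Num.Theory.
Import numFieldNormedType.Exports.

Local Open Scope classical_set_scope.
Local Open Scope complex_scope.
Local Open Scope ring_scope.

(** Even and odd functions are treated together: suppose y(-x) = e y(x) with
    e = 1 or e = -1.  The nodes satisfy x_(n-k) = -x_k, so the linear parts of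
    P_k(x) and e P_(n-k+1)(-x) agree and everything reduces to
    a_(n-k+1) = e a_k.  The terms c_j = (-1)^j Delta_j satisfy
    c_(n-j) = s c_j with s = (-1)^n e, so that reflecting the sums defining
    a_1 and the partial sums S_k of the c_j gives (1 + s) a_1 = - S_n and
    S_(n-k+1) = s (S_n - S_k), from which the symmetry of the a_k follows. *)

Lemma sum_nat_reflect (V : nmodType) (F : nat -> V) (k n : nat) :
  \sum_(k <= j < n) F (n - j)%N = \sum_(1 <= j < (n - k).+1) F j.
Proof.
rewrite big_add1 /= -{1}(add0n k) big_addn [RHS]big_nat_rev /= big_nat_cond.
rewrite [RHS]big_nat_cond; apply: eq_bigr => j /andP[/andP[_ jlt] _].
congr F; lia.
Qed.

Section ReflectedSums.

Variables (F : numFieldType) (n : nat) (s : F) (c : nat -> F).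
Hypothesis n_gt0 : (0 < n)%N.
Hypothesis c_refl : forall j, (0 < j < n)%N -> c (n - j)%N = s * c j.

Let S k := \sum_(1 <= j < k) c j.
Let a1 := - (n%:R)^-1 * \sum_(1 <= j < n) (n - j)%:R * c j.

(** Under [j -> n - j] the indices below [n - k + 1] become those from [k] to [n - 1], which
    [S n - S k] collects, since [S k] stops at [k - 1]. *)
Lemma partial_sum_reflect k : (0 < k <= n)%N -> S (n - k).+1 = s * (S n - S k).
Proof.
move=> /andP[k_gt0 k_le]; rewrite /S -sum_nat_reflect.
rewrite (big_cat_nat k_gt0 k_le) /= addrAC subrr add0r big_distrr /=.
rewrite big_nat_cond [RHS]big_nat_cond; apply: eq_bigr => j.
by move=> /andP[/andP[kj jn] _]; rewrite c_refl // (leq_trans k_gt0 kj).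
Qed.

(** Reflection turns the weights [n - j] into [j], and the two add up to the constant [n]. The
    factor [1 + s] is kept because it vanishes for [s = -1]. *)
Lemma weighted_sum_reflect : (1 + s) * a1 = - S n.
Proof.
have sW : s * \sum_(1 <= j < n) (n - j)%:R * c j = \sum_(1 <= j < n) j%:R * c j.
  rewrite -[n in RHS](subnK n_gt0) addn1 -sum_nat_reflect big_distrr /=.
  rewrite big_nat_cond [RHS]big_nat_cond; apply: eq_bigr => j.
  by move=> /andP[jn _]; rewrite c_refl //; ring.
have W : (1 + s) * (\sum_(1 <= j < n) (n - j)%:R * c j) = n%:R * S n.
  rewrite mulrDl mul1r sW -big_split /= big_distrr /=.
  rewrite big_nat_cond [RHS]big_nat_cond; apply: eq_bigr => j.
  move=> /andP[/andP[_ jn] _].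
  by rewrite -mulrDl -natrD subnK // ltnW.
have n_neq0 : n%:R != 0 :> F by rewrite pnatr_eq0 -lt0n.
by rewrite /a1 mulrCA W mulNr mulKf.
Qed.

Lemma shifted_partial_sum_reflect k : (0 < k <= n)%N ->
  a1 + S (n - k).+1 = - s * (a1 + S k).
Proof.
move=> k_in; rewrite partial_sum_reflect //.
(* The case [k = 1], where [S 1] is empty. It gives [(1 + s) * a1 + s * S n = 0]. *)
have Sn : S n = s * S n.
  have := @partial_sum_reflect 1; rewrite n_gt0 => /(_ isT).
  by rewrite subn1 prednK // [S 1]big_geq // subr0.
have -> : a1 + s * (S n - S k) = (1 + s) * a1 + s * S n - s * (a1 + S k) by ring.
by rewrite weighted_sum_reflect -Sn addNr add0r mulNr.
Qed.

End ReflectedSums.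

Section SplineSymmetry.

Variables (R : realType) (a : R) (n : nat) (y : R -> R[i]) (e : R[i]).
Hypotheses (a_gt0 : 0 < a) (n_gt0 : (0 < n)%N) (e_sqr : e * e = 1).
Hypothesis y_parity : forall x : R, x \in `[- a, a] -> y (- x) = e * y x.

Lemma node_reflect k : (k <= n)%N -> node a n (n - k) = - node a n k.
Proof.
move=> kn; have n_neq0 : n%:R != 0 :> R by rewrite pnatr_eq0 -lt0n.
by rewrite /node /step natrB //; field.
Qed.

Lemma node_in k : (k <= n)%N -> node a n k \in `[- a, a].
Proof.
move=> kn; have step_ge0 : 0 <= step a n.
  by rewrite /step divr_ge0 // mulr_ge0 // ltW.
have node_ge j : - a <= node a n j by rewrite /node lerDl mulr_ge0.
(* The upper bound is the lower bound at the reflected node [n - k]. *)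
by rewrite in_itv /= node_ge -[leLHS]opprK -node_reflect // lerNl node_ge.
Qed.

Lemma value_reflect k : (k <= n)%N -> y (node a n (n - k)) = e * y (node a n k).
Proof. by move=> kn; rewrite node_reflect // y_parity // node_in. Qed.

Lemma second_diff_reflect j : (0 < j < n)%N ->
  second_diff a n y (n - j) = e * second_diff a n y j.
Proof.
move=> /andP[j_gt0 j_lt]; rewrite /second_diff.
have -> : (n - j).-1 = (n - j.+1)%N by lia.
have -> : (n - j).+1 = (n - j.-1)%N by lia.
rewrite !value_reflect; try lia.
by ring.
Qed.

Lemma spline_coef_reflect k : (0 < k <= n)%N ->
  spline_coef a n y (n - k).+1 = e * spline_coef a n y k.
Proof.
move=> k_in; have /andP[k_gt0 k_le] := k_in.
have sgn j : (j <= n)%N -> (-1) ^+ (n - j) = (-1) ^+ n * (-1) ^+ j :> R[i].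
  by move=> jn; rewrite -signr_odd oddB // signr_addb !signr_odd.
have sgn_sqr : (-1) ^+ n * (-1) ^+ n = 1 :> R[i] by rewrite -expr2 sqrr_sign.
set c := fun j => (-1) ^+ j * second_diff a n y j.
have c_refl j : (0 < j < n)%N -> c (n - j)%N = (-1) ^+ n * e * c j.
  move=> jn; have /andP[_ /ltnW j_le] := jn.
  by rewrite /c second_diff_reflect // sgn //; ring.
have := shifted_partial_sum_reflect n_gt0 c_refl k_in.
rewrite /spline_coef /spline_coef1 -/c.
have -> : \sum_(1 <= j < n) (n - j)%:R * (-1) ^+ j * second_diff a n y j
    = \sum_(1 <= j < n) (n - j)%:R * c j.
  by apply: eq_bigr => j _; rewrite -mulrA.
move=> ->; rewrite !exprS sgn //.
set z := (X in _ * (_ * X) = _).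
(* One factor [(-1) ^+ n] comes from the sign in front of the coefficient, the other from [s];
   [ring] cannot cancel them by itself. *)
transitivity ((-1) ^+ n * (-1) ^+ n * (e * (-1 * (-1) ^+ k * z))); last first.
  by rewrite sgn_sqr mul1r.
by rewrite /z; ring.
Qed.

(** Piece [n - k + 1] has end nodes [-x_k] and [-x_(k-1)], so substituting [-X] sends its linear
    factors to [-r] and [-l] of piece [k], and their product to [l * r]. *)
Lemma spline_poly_reflect k : (0 < k <= n)%N ->
  spline_poly a n y k = e *: (spline_poly a n y (n - k + 1) \Po (- 'X)).
Proof.
move=> k_in; have /andP[k_gt0 k_le] := k_in.
rewrite /spline_poly addn1 spline_coef_reflect //=.
have -> : (n - k).+1 = (n - k.-1)%N by lia.
rewrite !value_reflect ?node_reflect; try lia.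
rewrite !(rmorphN (real_complex R)); move: (spline_coef _ _ _ _) => ak.
rewrite !(comp_polyB, comp_polyD, comp_polyZ, comp_polyM, comp_polyX, comp_polyC).
rewrite -!mul_polyC !polyCM !polyCN.
(* The outer [e] cancels the one carried by the reflected values and coefficient. *)
have eP : e%:P * e%:P = 1 by rewrite -polyCM e_sqr.
by ring: eP.
Qed.

End SplineSymmetry.

Theorem mainTheorem4 (R : realType) (a : R) (n : nat) (y : R -> R[i])
    (a_gt0 : 0 < a) (n_ge1 : (1 <= n)%N)
    (y_cont : {within `[- a, a], continuous (y : R -> R[i]^o)}) :
  (even_on a y ->
     forall k : nat, (1 <= k <= n)%N ->
       spline_poly a n y k = spline_poly a n y (n - k + 1) \Po (- 'X)) /\
  (odd_on a y ->
     forall k : nat, (1 <= k <= n)%N ->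
       spline_poly a n y k = - (spline_poly a n y (n - k + 1) \Po (- 'X))).
Proof.
split=> y_parity k k_in.
  rewrite (@spline_poly_reflect _ a n y 1) ?scale1r ?mulr1 // => x x_in.
  by rewrite mul1r y_parity.
rewrite (@spline_poly_reflect _ a n y (-1)) ?scaleN1r ?mulrNN ?mulr1 // => x x_in.
by rewrite mulN1r y_parity.
Qed.
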